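(* Let $n\ge 1$ and $1\le d\le n$ be integers, let $A_k<0<B_k$ ($k=1,\dots,n$) be real numbers, and let $\phi=\{\phi_k:\ k=1,2,\ldots,n\}$ be a system of random variables satisfying $A_k\le \phi_k\le B_k$ for every $k$. Let $G:\mathbb{R}^n\to\mathbb{R}^+$ be a function which is convex with respect to each variable separately. Then there exist $d$-independent mean zero random variables $\xi_1,\ldots,\xi_n$, where $\xi_k$ takes values in the two-point set $\{A_k,B_k\}$, such that $$\mathbf{E}\left[G(\phi_1,\ldots,\phi_n)\right]\le (1+\mu_d(\phi))\,\mathbf{E}\left[G(\xi_1,\ldots,\xi_n)\right].$$
   Context: $\mathbb{R}^+$ denotes the nonnegative reals. A system of random variables is called $d$-independent if any collection of $d$ of its elements is independent. With $C_k=\min\{-A_k,B_k\}$, the $d$-multiplicative error of $\phi$ is $$\mu_d(\phi)=\sum_{\emptyset\ne A\subset\{1,\ldots,n\},\ \#(A)\le d}\ \Big(\prod_{j\in A}C_j^{-1}\Big)\left|\mathbf{E}\Big[\prod_{j\in A}\phi_j\Big]\right|.$$ The random variables $\xi_k$ need not live on the same probability space as the $\phi_k$. *)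

(* Defs.v *)
From HB Require Import structures.
From mathcomp Require Import all_boot all_order all_algebra.
From mathcomp Require Import all_classical all_reals all_analysis.

Set Implicit Arguments.
Unset Strict Implicit.
Unset Printing Implicit Defensive.

Import Order.TTheory GRing.Theory Num.Theory.
Import numFieldNormedType.Exports.

Local Open Scope classical_set_scope.
Local Open Scope ring_scope.

(* The product rule over J with arbitrary Borel sets; the rule for the
   subfamilies of J follows by taking some of the B j to be setT. *)
Definition independent_on (disp : measure_display) (T : measurableType disp)
    (R : realType) (P : probability T R) (n : nat)
    (X : 'I_n -> {RV P >-> R}) (J : {set 'I_n}) : Prop :=
  forall B : 'I_n -> set R, (forall j, measurable (B j)) ->
    P (\bigcap_(j in [set` J]) (X j @^-1` B j)) =
    (\prod_(j in J) P (X j @^-1` B j))%E.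

Definition d_independent (disp : measure_display) (T : measurableType disp)
    (R : realType) (P : probability T R) (n d : nat)
    (X : 'I_n -> {RV P >-> R}) : Prop :=
  forall J : {set 'I_n}, #|J| = d -> independent_on X J.

(* The error is an extended real, as the library's expectation is; it is finite
   when the X j are bounded. *)
Definition mult_error (disp : measure_display) (T : measurableType disp)
    (R : realType) (P : probability T R) (n d : nat) (A B : 'I_n -> R)
    (X : 'I_n -> {RV P >-> R}) : \bar R :=
  (\sum_(J : {set 'I_n} | (J != finset.set0) && (#|J| <= d)%N)
     (\prod_(j in J) (Num.min (- A j) (B j))^-1)%:E *
     `| 'E_P[(fun w => \prod_(j in J) X j w)%R] |)%E.

Definition separately_convex (R : realType) (n : nat) (G : 'rV[R]_n -> R) :
    Prop :=
  forall (x : 'rV[R]_n) (k : 'I_n),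
    convex_function setT
      (fun t : R^o => G (\row_j (if j == k then t else x ord0 j)) : R^o).

(* Main.v *)
(* Convexity in each variable replaces phi by a random vector with values in the
   vertices of the box: for x in the box, G x is at most the average of G over
   the product law on the vertices with mean x, whose density with respect to
   the centered product law is prod_k (1 + c_k(s_k) x_k), with |c_k| <= 1/C_k.
   Averaging over phi gives the density f = sum_J E[phi_J] c_J.  The law of xi
   drops the terms of f with 1 <= #|J| <= d, each of absolute value at most
   |E[phi_J]| prod_(j in J) 1/C_j: adding their bounds mu_d to f first keeps the
   density nonnegative with total mass 1 + mu_d, and the marginals on at most d
   coordinates become those of the centered product law. *)

Require Import Defs.
From HB Require Import structures.
From mathcomp Require Import all_boot all_order all_algebra.
From mathcomp Require Import all_classical all_reals all_analysis.
From mathcomp Require Import measurable_realfun.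
From mathcomp Require Import ring lra.

Set Implicit Arguments.
Unset Strict Implicit.
Unset Printing Implicit Defensive.

Import Order.TTheory GRing.Theory Num.Theory.
Import numFieldNormedType.Exports.

Local Open Scope classical_set_scope.
Local Open Scope ring_scope.

(** * Laws on a two-point set *)

Section two_point.
Variables (R : realType) (a b : R).

Definition two_pt (s : bool) : R := if s then b else a.

Definition two_pt_prob (s : bool) : R :=
  if s then - a / (b - a) else b / (b - a).

(* The two-point law with mean t has density 1 + t * two_pt_slope with respect
   to the one with mean 0. *)
Definition two_pt_slope (s : bool) : R := if s then (- a)^-1 else - b^-1.

Hypothesis ab : a < 0 < b.

Lemma two_pt_prob_ge0 s : 0 <= two_pt_prob s.
Proof.
case/andP: ab => a0 b0; rewrite /two_pt_prob.
by case: s; rewrite divr_ge0//; lra.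
Qed.

Lemma two_pt_prob_sum : \sum_s two_pt_prob s = 1.
Proof. by case/andP: ab => a0 b0; rewrite big_bool/=; field; lra. Qed.

Lemma two_pt_mean0 : \sum_s two_pt_prob s * two_pt s = 0.
Proof. by case/andP: ab => a0 b0; rewrite big_bool/=; field; lra. Qed.

Lemma two_pt_slope_mean0 : \sum_s two_pt_prob s * two_pt_slope s = 0.
Proof.
case/andP: ab => a0 b0; rewrite big_bool/=; field.
by repeat (apply/andP; split); lra.
Qed.

Lemma norm_two_pt_slope s : `|two_pt_slope s| <= (Num.min (- a) b)^-1.
Proof.
case/andP: ab => a0 b0.
have m0 : 0 < Num.min (- a) b by rewrite lt_min b0 oppr_gt0 a0.
case: s; rewrite /= ?normrN gtr0_norm ?invr_gt0 ?oppr_gt0//;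
  by rewrite lef_pV2 ?posrE ?oppr_gt0// ge_min lexx ?orbT.
Qed.

(** The factor equals [(t - a) / (- a)] at the point [b] and [(b - t) / b] at the point [a]. *)
Lemma two_pt_density_ge0 s t : a <= t <= b -> 0 <= 1 + two_pt_slope s * t.
Proof.
case/andP: ab => a0 b0 /andP[at_ tb]; case: s => /=.
  by rewrite -[X in X + _](@divff _ (- a)) ?oppr_eq0 ?ltr0_neq0//
             [_^-1 * _]mulrC
             -mulrDl divr_ge0//; lra.
by rewrite mulNr -[X in X - _](@divff _ b) ?gt_eqF// [_^-1 * _]mulrC
           -mulrBl divr_ge0//; lra.
Qed.

(** The right side is the chord of [g] over [[a, b]] evaluated at [t]: the weights simplify to
    [(b - t) / (b - a)] at [a] and [(t - a) / (b - a)] at [b]. *)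
Lemma two_pt_convex_le (g : R -> R) t :
  convex_function setT (g : R^o -> R^o) -> a <= t <= b ->
  g t <= \sum_s two_pt_prob s * (1 + two_pt_slope s * t) * g (two_pt s).
Proof.
case/andP: ab => a0 b0 cg /andP[at_ tb].
have ba0 : 0 < b - a by lra.
set l := (b - t) / (b - a).
have l0 : 0 <= l by rewrite divr_ge0//; lra.
have l1 : l <= 1 by rewrite ler_pdivrMr// mul1r; lra.
have h : g (l * a + (1 - l) * b) <= l * g a + (1 - l) * g b.
  by have := cg (Itv01 l0 l1) a b (mem_setT _) (mem_setT _); rewrite !convRE.
have lt_ : l * a + (1 - l) * b = t by rewrite /l; field; lra.
rewrite lt_ in h; apply: (le_trans h).
rewrite le_eqVlt big_bool/= /l; apply/orP; left; apply/eqP.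
by field; repeat (apply/andP; split); lra.
Qed.

End two_point.

(* Resampling the k-th coordinate of a vector with independent coordinates does
   not change its law: (s, e) |-> (s[k := e], s k) is an involution. *)
Lemma resample_sum (R : realType) (I : finType) (w : I -> bool -> R)
    (H : {ffun I -> bool} -> R) (k : I) : \sum_e w k e = 1 ->
  \sum_(s : {ffun I -> bool}) (\prod_i w i (s i)) *
    (\sum_e w k e * H [ffun i => if i == k then e else s i]) =
  \sum_(s : {ffun I -> bool}) (\prod_i w i (s i)) * H s.
Proof.
move=> wk1.
under eq_bigr do rewrite big_distrr/=.
rewrite pair_bigA/=.
pose sw (z : {ffun I -> bool} * bool) :=
  ([ffun i => if i == k then z.2 else z.1 i], z.1 k).
have swK : involutive sw.
  move=> [s e]; congr pair; last by rewrite ffunE eqxx.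
  by apply/ffunP => i; rewrite !ffunE/=; case: eqP => [->|].
rewrite (reindex_inj (inv_inj swK))/=.
transitivity (\sum_(z : {ffun I -> bool} * bool)
    (\prod_i w i (z.1 i)) * H z.1 * w k z.2).
  apply: eq_bigr => -[s e] _ /=.
  have -> : [ffun i => if i == k then s k else
      [ffun i0 => if i0 == k then e else s i0] i] = s.
    by apply/ffunP => i; rewrite !ffunE; case: eqP => [->|].
  rewrite (bigD1 k)//= ffunE eqxx [in RHS](bigD1 k)//=.
  under eq_bigr => i ik do rewrite ffunE (negbTE ik).
  by ring.
rewrite -(pair_bigA _ (fun (s : {ffun I -> bool}) e =>
  (\prod_i w i (s i)) * H s * w k e))/=.
by apply: eq_bigr => s _; rewrite -big_distrr/= wk1 mulr1.
Qed.

(** * Separate convexity and the vertices of the box *)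

Section multilinear.
Variables (R : realType) (n : nat) (A B : 'I_n -> R).
Hypothesis AB : forall k, A k < 0 < B k.

Let p k := two_pt_prob (A k) (B k).
Let c k := two_pt_slope (A k) (B k).
Let v k := two_pt (A k) (B k).

Lemma separately_convex_le (G : 'rV[R]_n -> R) (x : 'rV[R]_n) :
  separately_convex G -> (forall k, A k <= x ord0 k <= B k) ->
  G x <= \sum_(s : {ffun 'I_n -> bool})
    (\prod_k (p k (s k) * (1 + c k (s k) * x ord0 k))) *
    G (\row_k v k (s k)).
Proof.
move=> cG xAB.
pose w k e := p k e * (1 + c k e * x ord0 k).
have w0 k e : 0 <= w k e.
  by rewrite mulr_ge0 ?two_pt_prob_ge0 ?two_pt_density_ge0.
have w1 k : \sum_e w k e = 1.
  under eq_bigr => e _ do rewrite /w mulrDr mulr1 mulrA.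
  by rewrite big_split/= -big_distrl/= two_pt_slope_mean0// mul0r addr0
             two_pt_prob_sum.
(* Coordinates move to the vertices one at a time: those in [r] are already random, the others are
   still those of [x]. *)
suff H (r : seq 'I_n) : uniq r -> G x <= \sum_(s : {ffun 'I_n -> bool})
    (\prod_k w k (s k)) * G (\row_k if k \in r then v k (s k) else x ord0 k).
  have := H _ (index_enum_uniq _).
  by under eq_bigr => s _ do under eq_mx => i j do rewrite mem_index_enum.
elim: r => [_|k r IH /= /andP[kr ur]].
  under eq_bigr => s _ do under eq_mx => i j do rewrite in_nil.
  rewrite -big_distrl/= -(bigA_distr_bigA w) big1 ?mul1r//.
  by rewrite (_ : \row_j x ord0 j = x)//; apply/rowP => i; rewrite mxE.
apply: (le_trans (IH ur)).
(* Resampling coordinate [k] in the target reduces the claim to a one-variable inequality for each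
   [s]; since [k] is not in [r], the point [y] below still has [k]-th coordinate [x ord0 k]. *)
rewrite -(resample_sum (fun s : {ffun 'I_n -> bool} =>
  G (\row_j if j \in k :: r then v j (s j) else x ord0 j)) (w1 k)).
apply: ler_sum => s _; apply: ler_wpM2l; first exact: prodr_ge0.
pose y : 'rV[R]_n := \row_j if j \in r then v j (s j) else x ord0 j.
have := two_pt_convex_le (AB k) (cG y k) (xAB k).
rewrite [X in G X <= _](_ : _ = y); last first.
  by apply/rowP => j; rewrite !mxE; case: eqP => [->|//]; rewrite (negbTE kr).
move=> /le_trans; apply; apply: ler_sum => e _.
apply: ler_wpM2l; first exact: w0.
rewrite [X in G X <= _](_ : _ = \row_j (if j \in k :: r
    then v j ([ffun i => if i == k then e else s i] j) else x ord0 j))//.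
by apply/rowP => j; rewrite !mxE ffunE inE; case: eqP => [->|].
Qed.

End multilinear.

Lemma prod_1D (R : comPzRingType) (I : finType) (a : I -> R) :
  \prod_i (1 + a i) = \sum_(J : {set I}) \prod_(j in J) a j.
Proof.
under eq_bigr do rewrite addrC.
rewrite bigA_distr; apply: eq_bigr => J _.
by rewrite [RHS]big_mkcond.
Qed.

(** * The truncated law on the vertices *)

Section truncated_law.
Variables (R : realType) (n d : nat) (A B : 'I_n -> R).
Hypothesis AB : forall k, A k < 0 < B k.

Let p k := two_pt_prob (A k) (B k).
Let c k := two_pt_slope (A k) (B k).

Definition slope_prod (J : {set 'I_n}) (s : {ffun 'I_n -> bool}) : R :=
  \prod_(j in J) c j (s j).

Lemma two_pt_density_expand (s : {ffun 'I_n -> bool}) (x : 'I_n -> R) :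
  \prod_k (1 + c k (s k) * x k) =
  \sum_(J : {set 'I_n}) slope_prod J s * \prod_(j in J) x j.
Proof.
by rewrite prod_1D; apply: eq_bigr => J _; rewrite -big_split.
Qed.

Lemma two_pt_prod_marginal (J : {set 'I_n}) (g : 'I_n -> bool -> R) :
  \sum_(s : {ffun 'I_n -> bool}) (\prod_k p k (s k)) *
    (\prod_(j in J) g j (s j)) = \prod_(j in J) \sum_e p j e * g j e.
Proof.
rewrite (eq_bigr (fun s : {ffun 'I_n -> bool} => \prod_k (p k (s k) *
     (if k \in J then g k (s k) else 1)))); last first.
  by move=> s _; rewrite big_split/= -big_mkcond.
rewrite -(bigA_distr_bigA (fun k e => p k e * (if k \in J then g k e else 1))).
rewrite [RHS]big_mkcond; apply: eq_bigr => k _; case: ifP => // _.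
by under eq_bigr do rewrite mulr1; exact: two_pt_prob_sum.
Qed.

(* Integrating out the coordinates in K outside J kills the term of K, because
   each slope has mean 0. *)
Lemma two_pt_marginal (J K : {set 'I_n}) (g : 'I_n -> bool -> R) :
  ~~ (K \subset J) ->
  \sum_(s : {ffun 'I_n -> bool}) (\prod_k p k (s k)) *
    (slope_prod K s * \prod_(j in J) g j (s j)) = 0.
Proof.
case/subsetPn => k kK kJ.
pose h k e := (if k \in K then c k e else 1) * (if k \in J then g k e else 1).
transitivity (\sum_(s : {ffun 'I_n -> bool}) (\prod_k p k (s k)) *
    \prod_(j in (finset.setT : {set 'I_n})) h j (s j)).
  apply: eq_bigr => s _; congr (_ * _).
  rewrite [RHS](eq_bigl predT) => [|i]; last by rewrite finset.in_setT.
  by rewrite big_split/= -!big_mkcond.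
rewrite two_pt_prod_marginal (bigD1 k) ?finset.in_setT//=.
under eq_bigr do rewrite /h kK (negbTE kJ) mulr1.
by rewrite two_pt_slope_mean0// mul0r.
Qed.

Variable m : {set 'I_n} -> R.

(** When [m J] is the moment of the product of the [phi j] over [J], this is the multiplicative
    error as a real number. *)
Definition low_mass : R :=
  \sum_(J : {set 'I_n} | (J != finset.set0) && (#|J| <= d)%N)
    (\prod_(j in J) (Num.min (- A j) (B j))^-1) * `|m J|.

(** The factor [(1 + low_mass)^-1] normalizes the constant term of the density to 1. Nonnegativity
    is not built in: it comes from [truncated_law_ge] once [m] consists of moments of a system with
    values in the box. *)
Definition truncated_law (s : {ffun 'I_n -> bool}) : R :=
  (\prod_k p k (s k)) * (1 + (1 + low_mass)^-1 *
    \sum_(K : {set 'I_n} | (d < #|K|)%N) m K * slope_prod K s).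

Lemma low_mass_ge0 : 0 <= low_mass.
Proof.
apply: sumr_ge0 => J _; rewrite mulr_ge0// prodr_ge0// => j _.
by have /andP[? ?] := AB j; rewrite invr_ge0 ltW// lt_min oppr_gt0; apply/andP.
Qed.

(** Terms of order above [d] and the constant term agree on both sides; each remaining term is at
    most its summand in [low_mass]. This yields both the nonnegativity of the law and the final
    comparison of expectations. *)
Lemma truncated_law_ge (s : {ffun 'I_n -> bool}) : m finset.set0 = 1 ->
  (\prod_k p k (s k)) * \sum_(J : {set 'I_n}) m J * slope_prod J s <=
  (1 + low_mass) * truncated_law s.
Proof.
move=> m0; have mu0 : 0 < 1 + low_mass by have := low_mass_ge0; lra.
rewrite /truncated_law mulrCA ler_wpM2l//.
  by apply: prodr_ge0 => k _; exact: two_pt_prob_ge0.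
rewrite mulrDr mulr1 mulrA divff ?gt_eqF// mul1r.
rewrite (bigID (fun J : {set 'I_n} => (d < #|J|)%N))/= addrC lerD2r.
rewrite (bigD1 finset.set0) ?cards0//= m0 /slope_prod big_set0 mulr1 lerD2l.
rewrite (eq_bigl (fun J : {set 'I_n} => (J != finset.set0) && (#|J| <= d)%N));
  last by move=> J; rewrite -leqNgt andbC.
apply: ler_sum => J _; apply: (le_trans (ler_norm _)).
rewrite normrM mulrC ler_wpM2r// normr_prod; apply: ler_prod => j _.
by rewrite normr_ge0 norm_two_pt_slope.
Qed.

(** A set of more than [d] indices is never contained in [J], so [two_pt_marginal] kills every
    correction term. Empty [J] gives the total mass, singletons the means, indicators [g] the
    independence. *)
Lemma truncated_law_marginal (J : {set 'I_n}) (g : 'I_n -> bool -> R) :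
  (#|J| <= d)%N ->
  \sum_s truncated_law s * \prod_(j in J) g j (s j) =
  \prod_(j in J) \sum_e p j e * g j e.
Proof.
move=> Jd; rewrite -two_pt_prod_marginal.
under eq_bigr => s _.
  rewrite /truncated_law mulrDr mulr1 mulrDl mulrCA -mulrA.
  rewrite big_distrr big_distrl/=.
  over.
rewrite big_split/= -[RHS]addr0; congr (_ + _).
rewrite -big_distrr/= exchange_big/= big1 ?mulr0// => K dK.
under eq_bigr => s _.
  rewrite (_ : _ * _ = m K * ((\prod_k p k (s k)) *
    (slope_prod K s * \prod_(j in J) g j (s j)))); last by ring.
  over.
rewrite -big_distrr/= two_pt_marginal ?mulr0//.
by apply: contraTN dK => /subset_leq_card KJ; rewrite -leqNgt (leq_trans KJ).
Qed.

End truncated_law.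

(** * Lower integrals and finite probability spaces *)

Section lower_integral.
Import HBNNSimple.

(* f need not be measurable: for f >= 0 the library's integral is then the lower
   integral, a supremum over simple functions below f. *)
Lemma ae_ge0_le_lower_integral d (T : measurableType d) (R : realType)
    (mu : {measure set T -> \bar R}) (f h : T -> \bar R) :
  (forall x, 0 <= f x)%E -> (forall x, 0 <= h x)%E -> measurable_fun setT h ->
  {ae mu, forall x, (f x <= h x)%E} ->
  (\int[mu]_x f x <= \int[mu]_x h x)%E.
Proof.
move=> f0 h0 mh fh; rewrite ge0_integralTE//.
apply: ge_ereal_sup => _ [g /= gf <-].
rewrite -integralT_nnsfun; apply: ae_ge0_le_integral => //.
- by move=> x _; rewrite lee_fin.
- exact/measurable_EFinP.
- by apply: filterS fh => x fhx _; exact: le_trans (gf x) fhx.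
Qed.

End lower_integral.

(** The space is [nat], where every set is measurable, with mass [r (e k)] at each [k < #|I|] for an
    enumeration [e] of [I]. The default [i0] is the value of [e] on the remaining integers, which
    have mass zero. *)
Lemma finite_probability (R : realType) (I : finType) (i0 : I) (r : I -> R) :
  (forall i, 0 <= r i) -> \sum_i r i = 1 ->
  exists (disp : measure_display) (T : measurableType disp)
    (Q : probability T R) (e : T -> I),
    (forall f : I -> R, measurable_fun setT (f \o e)) /\
    (forall f : I -> R, ('E_Q[f \o e] = (\sum_i r i * f i)%:E)%E) /\
    forall U : set I, Q (e @^-1` U) = (\sum_i r i * (i \in U)%:R)%:E.
Proof.
move=> r0 r1.
pose e k := nth i0 (enum I) k.
have sum_e (f : I -> R) : \sum_(k < #|I|) f (e k) = \sum_i f i.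
  rewrite [RHS](reindex _ (onW_bij _ (enum_val_bij I)))/=.
  apply: eq_bigr => k _; congr f; apply: set_nth_default.
  by rewrite -cardE ltn_ord.
pose mu : {measure set nat -> \bar R} :=
  msum (fun k => mscale (NngNum (r0 (e k))) (@dirac _ nat k R)) #|I|.
have ge0E (f : nat -> \bar R) : (forall k, 0 <= f k)%E ->
    (\int[mu]_k f k = \sum_(k < #|I|) (r (e k))%:E * f k)%E.
  move=> f0; rewrite ge0_integral_measure_sum//; apply: eq_bigr => k _.
  by rewrite ge0_integral_mscale//= integral_dirac//= diracT mul1e.
have mu1 : mu setT = 1%E.
  rewrite -[LHS]mul1e -integral_cst//= ge0E//.
  under eq_bigr do rewrite mule1.
  by rewrite sumEFin sum_e r1.
pose Q : probability nat R :=
  HB.pack (Measure.sort mu) (Measure_isProbability.Build _ _ _ mu mu1).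
suff E (f : I -> R) : ('E_Q[f \o e] = (\sum_i r i * f i)%:E)%E.
  exists _, nat, Q, e; split=> //; split=> // U.
  by rewrite -(E (fun i => (i \in U)%:R)) -expectation_indic.
(* [ge0E] covers nonnegative functions only, hence the split of [f] into positive and negative
   parts. *)
rewrite unlock -[LHS]/(\int[mu]_k (f (e k))%:E)%E integralE !ge0E//.
rewrite -(sum_e (fun i => r i * f i)).
under eq_bigr do rewrite funeposE -EFin_max -EFinM.
under [X in (_ - X)%E]eq_bigr do rewrite funenegE -EFinN -EFin_max -EFinM.
rewrite !sumEFin -EFinB -sumrB; congr (_%:E).
apply: eq_bigr => k _; rewrite -mulrBr; congr (_ * _).
have [f0|f0] := leP 0 (f (e k)).
  by rewrite (max_idPr _) ?oppr_le0// subr0.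
by rewrite (max_idPl _) ?oppr_ge0 ?ltW// sub0r opprK.
Qed.

(** * Moments of products of bounded variables *)

Section bounded_products.
Variables (d : measure_display) (T : measurableType d) (R : realType).
Variables (P : probability T R) (I : finType) (a b : I -> R).
Variable X : I -> T -> R.
Hypothesis mX : forall i, measurable_fun setT (X i).
Hypothesis Xab : forall i w, a i <= X i w <= b i.

Lemma integrable_prod (J : {set I}) :
  P.-integrable setT (EFin \o (fun w => \prod_(j in J) X j w)).
Proof.
apply: measurable_bounded_integrable => //.
- by rewrite -ge0_fin_numE// fin_num_measure.
- under eq_fun do rewrite -big_enum/=.
  by apply: measurable_prod => i _; exact: mX.
exists (\prod_(j in J) Num.max `|a j| `|b j|); split; first exact: num_real.
move=> M hM w _ /=; apply: ltW; apply: le_lt_trans hM.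
rewrite normr_prod; apply: ler_prod => j _; rewrite normr_ge0/=.
have /andP[aX Xb] := Xab j w; rewrite le_max.
have [X0|X0] := leP 0 (X j w).
  by rewrite orbC (ger0_norm X0) (le_trans Xb) ?ler_norm.
rewrite (ltr0_norm X0) -[X in _ <= X]normrN (le_trans _ (ler_norm _))//.
by rewrite lerN2.
Qed.

Lemma measurable_multilinear (q : {set I} -> R) :
  measurable_fun setT (fun w => \sum_(J : {set I}) q J * \prod_(j in J) X j w).
Proof.
apply: measurable_sum => J; apply: measurable_funM => //.
by apply/measurable_EFinP; have /integrableP[] := integrable_prod J.
Qed.

Lemma expectation_multilinear (q : {set I} -> R) :
  ('E_P[(fun w => \sum_(J : {set I}) q J * \prod_(j in J) X j w)%R] =
  (\sum_(J : {set I}) q J *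
     fine 'E_P[(fun w => \prod_(j in J) X j w)%R])%R%:E)%E.
Proof.
rewrite expectation.unlock; under eq_integral do rewrite -sumEFin.
rewrite integral_sum//=; last first.
  move=> J; have := integrableZl measurableT (q J) (integrable_prod J).
  by apply: eq_integrable.
rewrite -sumEFin; apply: eq_bigr => J _.
under eq_integral do rewrite EFinM.
rewrite integralZl//; last exact: integrable_prod.
rewrite EFinM fineK//; apply: integrable_fin_num => //.
exact: integrable_prod.
Qed.

End bounded_products.

(** * Construction of the variables [xi] and comparison of expectations *)

Theorem theorem1p1 (R : realType) (n d : nat)
    (hn : (1 <= n)%N) (hd : (1 <= d <= n)%N)
    (A B : 'I_n -> R) (hAB : forall k, A k < 0 < B k)
    (disp : measure_display) (T : measurableType disp) (P : probability T R)
    (phi : 'I_n -> {RV P >-> R})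
    (hphi : forall k, {ae P, forall w, A k <= phi k w <= B k})
    (G : 'rV[R]_n -> R) (hG0 : forall x, 0 <= G x)
    (hG : separately_convex G) :
  exists (disp' : measure_display) (T' : measurableType disp')
    (Q : probability T' R) (xi : 'I_n -> {RV Q >-> R}),
    [/\ d_independent d xi,
        forall k, ('E_Q[xi k] = 0)%E,
        forall k w, xi k w = A k \/ xi k w = B k &
        ('E_P[(fun w => G (\row_k phi k w))%R] <=
         (1 + mult_error d A B phi) *
         'E_Q[(fun w => G (\row_k xi k w))%R])%E].
Proof.
have /andP[d0 dn] := hd.
(* The bounds on [phi] hold almost everywhere; clipping makes them hold at every point without
   changing the moments. *)
pose psi k w := Num.max (A k) (Num.min (B k) (phi k w)).
have mpsi k : measurable_fun setT (psi k).
  by apply: measurable_maxr => //; apply: measurable_minr.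
have AltB k : A k <= B k by have /andP[? ?] := hAB k; lra.
have psiAB k w : A k <= psi k w <= B k.
  by rewrite le_max lexx ge_max AltB ge_min lexx.
have phi_psi : {ae P, forall w, forall k, phi k w = psi k w}.
  apply: filter_forall => k; apply: filterS (hphi k) => w /andP[Aphi phiB].
  by rewrite /psi (min_idPr phiB) (max_idPr Aphi).
pose m (J : {set 'I_n}) := fine 'E_P[(fun w => \prod_(j in J) psi j w)%R].
have Ephi (J : {set 'I_n}) :
    ('E_P[(fun w => \prod_(j in J) phi j w)%R] = (m J)%:E)%E.
  have fin_psi : ('E_P[(fun w => \prod_(j in J) psi j w)%R] \is a fin_num)%E.
    rewrite expectation.unlock; apply: integrable_fin_num => //.
    exact: integrable_prod mpsi psiAB J.
  rewrite /m fineK// expectation.unlock; apply: ae_eq_integral => //.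
  - apply/measurable_EFinP; under eq_fun do rewrite -big_enum/=.
    by apply: measurable_prod => i _.
  - by have /integrableP[] := integrable_prod P mpsi psiAB J.
  - by apply: filterS phi_psi => w e _; congr (_%:E); apply: eq_bigr => j _.
have m0 : m finset.set0 = 1.
  rewrite /m; under [X in ('E_P[X])%E]eq_fun do rewrite big_set0.
  by rewrite expectation_cst.
set mu := low_mass d A B m.
have mu_ge0 : 0 <= mu by exact: low_mass_ge0.
have errE : mult_error d A B phi = mu%:E.
  rewrite /mult_error /mu /low_mass -sumEFin.
  by apply: eq_bigr => J _; rewrite Ephi EFinM.
pose r := truncated_law d A B m.
have p0 (s : {ffun 'I_n -> bool}) : 0 <= \prod_k two_pt_prob (A k) (B k) (s k).
  by apply: prodr_ge0 => k _; exact: two_pt_prob_ge0.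
(* By [truncated_law_ge] it suffices that the averaged density is nonnegative, and it is the
   expectation of a product of nonnegative factors [1 + c_k psi_k]. *)
have r0 s : 0 <= r s.
  rewrite -(pmulr_rge0 (x := 1 + mu)); last by lra.
  apply: (le_trans _ (truncated_law_ge d hAB s m0)); rewrite mulr_ge0//.
  under eq_bigr do rewrite mulrC.
  rewrite -lee_fin -(expectation_multilinear P mpsi psiAB
    (slope_prod A B ^~ s)).
  apply: expectation_ge0 => w; rewrite -two_pt_density_expand.
  by apply: prodr_ge0 => k _; exact: two_pt_density_ge0.
have r1 : \sum_s r s = 1.
  have := truncated_law_marginal hAB m (J := finset.set0) (fun _ _ => 1).
  rewrite cards0 => /(_ d isT); rewrite [X in _ = X]big_set0 => E1.
  by apply: etrans E1; apply: eq_bigr => s _; rewrite big_set0 mulr1.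
have [disp' [T' [Q [e [me [EQ QU]]]]]] :=
  finite_probability [ffun _ => true] r0 r1.
pose v k (s : {ffun 'I_n -> bool}) := two_pt (A k) (B k) (s k).
pose xi k : {RV Q >-> R} :=
  HB.pack (v k \o e) (isMeasurableFun.Build _ _ _ _ _ (me (v k))).
exists disp', T', Q, xi; split.
- move=> J Jd U mU.
  (* Stated for all sizes up to [d], so that singletons, allowed since [1 <= d], identify each
     factor as the probability of one event. *)
  have QJ (K : {set 'I_n}) : (#|K| <= d)%N ->
      Q (\bigcap_(j in [set` K]) (xi j @^-1` U j)) =
      (\prod_(j in K) \sum_b two_pt_prob (A j) (B j) b *
         (two_pt (A j) (B j) b \in U j)%:R)%:E.
    move=> Kd; rewrite -(truncated_law_marginal hAB m _ Kd).
    transitivity (Q (e @^-1` [set s | forall j, j \in K -> v j s \in U j])).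
      congr (Q _); apply/seteqP; split => w /= H j jK.
        by rewrite inE; exact: H.
      by have := H j jK; rewrite inE.
    rewrite QU; congr (_%:E); apply: eq_bigr => s _; congr (_ * _).
    rewrite -natr_prod; congr (_%:R).
    have [sU|] := boolP (s \in _).
      by rewrite big1// => j jK; move: sU; rewrite inE => /(_ j jK) ->.
    rewrite notin_setE /= => /existsNP[j /not_implyP[jK /negP/negbTE vjU]].
    by rewrite (bigD1 j)//= [v j s \in U j]vjU mul0n.
  rewrite QJ ?Jd// -prodEFin; apply: eq_bigr => j jJ.
  have := QJ (finset.set1 j); rewrite cards1 => /(_ d0).
  rewrite [X in _ = X -> _]/= big_set1 => <-; congr (Q _).
  apply/seteqP; split => w /=; first by apply; rewrite /= finset.inE.
  by move=> wU i /=; rewrite finset.inE => /eqP ->.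
- move=> k.
  rewrite (EQ (v k)); congr (_%:E).
  have := truncated_law_marginal hAB m (J := finset.set1 k)
    (fun j b => two_pt (A j) (B j) b).
  rewrite cards1 => /(_ d d0); rewrite [X in _ = X]big_set1.
  rewrite two_pt_mean0// => E0.
  by apply: etrans E0; apply: eq_bigr => s _; rewrite big_set1.
- by move=> k w; rewrite /= /v /two_pt; case: (e w k); [right|left].
pose Gv (s : {ffun 'I_n -> bool}) := G (\row_k v k s).
rewrite errE [X in (_ <= _ * X)%E](EQ Gv).
(* These are the coefficients of the multilinear interpolant of [G] at the vertices; [h] is that
   interpolant evaluated at [psi]. *)
pose q (J : {set 'I_n}) := \sum_(s : {ffun 'I_n -> bool})
  (\prod_k two_pt_prob (A k) (B k) (s k)) * Gv s * slope_prod A B J s.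
pose h w := \sum_(J : {set 'I_n}) q J * \prod_(j in J) psi j w.
have Gh w : G (\row_k psi k w) <= h w.
  have -> : h w = \sum_(s : {ffun 'I_n -> bool})
      (\prod_k (two_pt_prob (A k) (B k) (s k) *
        (1 + two_pt_slope (A k) (B k) (s k) * psi k w))) * Gv s.
    rewrite /h; under eq_bigr do rewrite big_distrl/=.
    rewrite exchange_big/=; apply: eq_bigr => s _.
    rewrite big_split/= two_pt_density_expand mulrAC big_distrr/=.
    by apply: eq_bigr => J _; ring.
  apply: le_trans (separately_convex_le hAB hG _) _ => [k|].
    by rewrite mxE.
  by under eq_bigr => s _ do under eq_bigr => k _ do rewrite mxE.
apply: (@le_trans _ _ 'E_P[h]%E).
  rewrite expectation.unlock; apply: ae_ge0_le_lower_integral.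
  - by move=> w; rewrite lee_fin.
  - by move=> w; rewrite lee_fin (le_trans _ (Gh w)).
  - by apply/measurable_EFinP; exact: (measurable_multilinear P mpsi psiAB).
  - apply: filterS phi_psi => w e_w; rewrite lee_fin.
    rewrite (_ : \row_k phi k w = \row_k psi k w)//.
    by apply/rowP => k; rewrite !mxE.
rewrite (expectation_multilinear P mpsi psiAB) -EFinD -EFinM lee_fin.
(* Exchanging the sums writes the expectation of [h] as a sum over vertices against the averaged
   density, where [truncated_law_ge] applies termwise because [G] is nonnegative. *)
rewrite (_ : \sum_J _ = \sum_(s : {ffun 'I_n -> bool}) Gv s *
    ((\prod_k two_pt_prob (A k) (B k) (s k)) *
     \sum_(J : {set 'I_n}) m J * slope_prod A B J s)).
  rewrite big_distrr/=; apply: ler_sum => s _.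
  rewrite [leRHS]mulrA [leRHS]mulrC.
  by apply: ler_wpM2l; [exact: hG0|exact: truncated_law_ge].
under [RHS]eq_bigr do rewrite !big_distrr/=.
rewrite exchange_big/=; apply: eq_bigr => J _.
rewrite big_distrl/=; apply: eq_bigr => s _; rewrite -/(m J).
by ring.
Qed.
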